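(* Let $\mathrm{Dis}$ be a linear disparity measure with weighting function $w_{\mathrm{Dis}}$, and suppose that for $a\in\{0,1\}$ both $\eta_a(X)$ and $w_{\mathrm{Dis}}(X,a)$ have probability density functions when $X\sim\mathbb P_{X\mid A=a}$. Let $f_{\mathrm{Dis},0}(x,a)=I(\eta_a(x)>\frac12)$ and $D_{\mathrm{Dis}}(0)=\mathrm{Dis}(f_{\mathrm{Dis},0})$. Then the tradeoff function $$T(\delta)=\inf\{R(f):f\in\mathcal F,\ |\mathrm{Dis}(f)|\le\delta\}$$ is convex on $[0,|D_{\mathrm{Dis}}(0)|]$.
   Context: Let $(X,A,Y)\sim\mathbb P$ be a random triple with values in $\mathcal X\times\{0,1\}\times\{0,1\}$, $p_a=\mathbb P(A=a)>0$, $\eta_a(x)=\mathbb P(Y=1\mid A=a,X=x)$, and $\mathbb P_{X\mid A=a}$ the conditional law of $X$ given $A=a$. $I(\cdot)$ is the indicator function. A (randomized) classifier is a measurable $f:\mathcal X\times\{0,1\}\to[0,1]$; $\mathcal F$ is the set of all of them. Its prediction satisfies $\widehat Y_f\mid X=x,A=a\sim\mathrm{Bernoulli}(f(x,a))$, conditionally independent of $Y$ given $(X,A)$. The misclassification error is $R(f)=\mathbb P(Y\ne\widehat Y_f)$. A disparity measure $\mathrm{Dis}:\mathcal F\to[-1,1]$ is linear if there is a weighting function $w_{\mathrm{Dis}}:\mathcal X\times\{0,1\}\to\mathbb R$ (depending on $\mathbb P$) such that for all $f\in\mathcal F$, $\mathrm{Dis}(f)=\int f(x,a)\,w_{\mathrm{Dis}}(x,a)\,d\mathbb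 P_{X,A}(x,a)$. *)

(* Defs.v *)
From HB Require Import structures.
From mathcomp Require Import all_boot all_order all_algebra.
From mathcomp Require Import all_classical all_reals all_analysis.
From mathcomp Require Import measurable_realfun.

Set Implicit Arguments.
Unset Strict Implicit.
Unset Printing Implicit Defensive.

Import Order.TTheory GRing.Theory Num.Theory.
Import numFieldNormedType.Exports.

Local Open Scope classical_set_scope.
Local Open Scope ring_scope.

(* The random triple (X, A, Y) is given by its law, a probability on
   (X * {0,1}) * {0,1}; [true] encodes 1, so that (X, A) is [fst] and
   Y is [snd]. *)

Section fair_classification.
Context {d : measure_display} {X : measurableType d} {R : realType}.

Record classifier := Classifier {
  classifier_fun :> X * bool -> R ;
  measurable_classifier : measurable_fun [set: X * bool] classifier_fun ;
  classifier_range : forall z, 0 <= classifier_fun z <= 1 }.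

Variable P : probability (X * bool * bool)%type R.

Definition law_XA : set (X * bool) -> \bar R := pushforward P fst.

Definition prA (a : bool) : R := fine (P [set t | t.1.2 = a]).

Definition cond_law_X (a : bool) (B : set X) : \bar R :=
  (fine (P [set t | B t.1.1 /\ t.1.2 = a]) / prA a)%:E.

(* A version of the conditional probability P(Y = 1 | A = a, X = x). *)
Record regression := Regression {
  regression_fun :> bool -> X -> R ;
  measurable_regression :
    forall a, measurable_fun [set: X] (regression_fun a) ;
  regression_range : forall a x, 0 <= regression_fun a x <= 1 ;
  regression_condP : forall B : set (X * bool), measurable B ->
    (\int[law_XA]_(z in B) (regression_fun z.2 z.1)%:E)%E
    = P [set t | B t.1 /\ t.2 = true] }.

(* The joint law of ((X, A, Y), Yhat) when the conditional law of Yhat given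
   (X, A, Y) is Bernoulli(f(X, A)); this encodes both the conditional law of
   Yhat given (X, A) and the conditional independence of Yhat and Y. *)
Definition prediction_law (f : classifier) (S : set (X * bool * bool * bool))
    : \bar R :=
  (\int[P]_t bernoulli_prob (f t.1) (xsection S t))%E.

Definition risk (f : classifier) : R :=
  fine (prediction_law f [set u | u.1.2 <> u.2]).

Definition disparity_measure (Dis : classifier -> R) : Prop :=
  forall f, -1 <= Dis f <= 1.

(* The identity is between extended reals, so that the integrals are required
   to be finite. *)
Definition linear_disparity (Dis : classifier -> R) (w : X * bool -> R)
    : Prop :=
  measurable_fun [set: X * bool] w /\
  forall f : classifier, (Dis f)%:E = (\int[law_XA]_z (f z * w z)%:E)%E.

Definition has_density (nu : set R -> \bar R) : Prop :=
  exists g : R -> R, [/\ measurable_fun [set: R] g, forall r, 0 <= g r &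
    forall B : set R, measurable B ->
      nu B = (\int[lebesgue_measure]_(r in B) (g r)%:E)%E].

Lemma measurable_threshold_classifier (eta : regression) :
  measurable_fun [set: X * bool]
    (fun z : X * bool => (2^-1 < eta z.2 z.1)%R%:R : R).
Proof.
have me : measurable_fun [set: X * bool] (fun z : X * bool => eta z.2 z.1).
  rewrite (_ : (fun z => _) =
    fun z : X * bool => if z.2 then eta true z.1 else eta false z.1).
    apply: measurable_fun_ifT => //; apply: measurableT_comp => //;
      exact: measurable_regression.
  by apply/funext => -[x []].
rewrite (_ : (fun z => _) = fun z : X * bool =>
  if 2^-1 < eta z.2 z.1 then 1 else 0); last first.
  by apply/funext => z; case: ifP.
by apply: measurable_fun_ifT => //; exact: measurable_fun_ltr.
Qed.

Lemma threshold_classifier_range (eta : regression) (z : X * bool) :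
  0 <= ((2^-1 < eta z.2 z.1)%R%:R : R) <= 1.
Proof. by case: (2^-1 < _); rewrite ?lexx ?ler01. Qed.

Definition threshold_classifier (eta : regression) : classifier :=
  Classifier (@measurable_threshold_classifier eta)
    (@threshold_classifier_range eta).

Definition tradeoff (Dis : classifier -> R) (delta : R) : R :=
  inf [set risk f | f in [set f : classifier | `|Dis f| <= delta]].

End fair_classification.

Arguments classifier {d} X R.

(* Main.v *)
Require Import Defs.
From HB Require Import structures.
From mathcomp Require Import all_boot all_order all_algebra.
From mathcomp Require Import all_classical all_reals all_analysis.
From mathcomp Require Import measurable_realfun ring lra.
Set Implicit Arguments.
Unset Strict Implicit.
Unset Printing Implicit Defensive.
Import Order.TTheory GRing.Theory Num.Theory.
Import numFieldNormedType.Exports.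
Local Open Scope classical_set_scope.
Local Open Scope ring_scope.

(** Both the risk and a linear disparity are affine in the classifier, so
    mixing a classifier feasible at [x] with one feasible at [y] gives one
    feasible at the mixture of [x] and [y], whose risk is the mixture of the
    risks. The constraint set is never empty because the zero classifier has
    zero disparity, so the infima are genuine. *)

Lemma convex_optimal_value (R : realType) (F : Type) (risk Dis : F -> R)
    (f0 : F) (D : set (convex_lmodType R^o)) :
  (forall f, 0 <= risk f) -> Dis f0 = 0 ->
  (forall (t : {i01 R}) f g, exists h,
    risk h = t%:num * risk f + (1 - t%:num) * risk g /\
    Dis h = t%:num * Dis f + (1 - t%:num) * Dis g) ->
  {in D, forall x : R, 0 <= x} ->
  convex_function D
    (fun x : R => inf [set risk f | f in [set f | `|Dis f| <= x]]).
Proof.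
move=> risk0 Dis0 mix D0 t x y xD yD.
pose T (z : R) := inf [set risk f | f in [set f | `|Dis f| <= z]].
have infT z : 0 <= z -> has_inf [set risk f | f in [set f | `|Dis f| <= z]].
  move=> z0; split; first by exists (risk f0), f0; rewrite //= Dis0 normr0.
  by exists 0 => _ [f _ <-].
have t0 : 0 <= t%:num by [].
have t1 : 0 <= 1 - t%:num by rewrite subr_ge0.
(* The infima need not be attained, so the inequality is proved up to an arbitrary slack [e], using
   feasible [f] and [g] within [e] of the optimal values at [x] and [y]. *)
apply/ler_addgt0Pr => e e0.
have [_ [f /= fx <-] lf] := inf_adherent e0 (infT x (D0 _ xD)).
have [_ [g /= gy <-] lg] := inf_adherent e0 (infT y (D0 _ yD)).
have [h [rh Dh]] := mix t f g.
apply: (@le_trans _ _ (risk h)).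
  apply: ge_inf; first by exists 0 => _ [k _ <-].
  exists h => //=; rewrite Dh (le_trans (ler_normD _ _))//.
  rewrite !normrM (ger0_norm t0) (ger0_norm t1).
  (* The abstract convex combination unfolds by conversion to the explicit weighted sum. *)
  rewrite [leRHS](_ : _ = t%:num * x + (1 - t%:num) * y) //.
  by apply: lerD; exact: ler_wpM2l.
(* The weights sum to 1, so a slack of [e] in each risk costs exactly [e] in the mixture. *)
rewrite rh (_ : _ + e = t%:num * (T x + e) + (1 - t%:num) * (T y + e)).
  by rewrite lerD// ler_wpM2l// ltW.
rewrite [conv _ _ _ in LHS](_ : _ = t%:num * T x + (1 - t%:num) * T y) //.
ring.
Qed.

(** Serves twice: under [P] for the risk, and under the law of (X, A) for the disparity. *)
Lemma Rintegral_linear_combination d (T : measurableType d) (R : realType)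
    (mu : {measure set T -> \bar R}) (a b : R) (u v : T -> R) :
  mu.-integrable setT (EFin \o u) -> mu.-integrable setT (EFin \o v) ->
  \int[mu]_x (a * u x + b * v x) =
  a * \int[mu]_x u x + b * \int[mu]_x v x.
Proof.
move=> iu iv; rewrite RintegralD ?RintegralZl//.
- by apply: eq_integrable (integrableZl _ a iu).
- by apply: eq_integrable (integrableZl _ b iv).
Qed.

Section fair_classification_convexity.
Context d (X : measurableType d) (R : realType).
Implicit Types (f g : classifier X R) (t : {i01 R}).

Lemma measurable_mix t f g : measurable_fun [set: X * bool]
  (fun z => t%:num * f z + (1 - t%:num) * g z).
Proof.
by apply: measurable_funD; apply: measurable_funM => //;
  exact: measurable_classifier.
Qed.

Lemma mix_range t f g z : 0 <= t%:num * f z + (1 - t%:num) * g z <= 1.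
Proof.
have /andP[f0 f1] := classifier_range f z.
have /andP[g0 g1] := classifier_range g z.
have t0 : 0 <= t%:num by [].
have t1 : t%:num <= 1 by [].
by apply/andP; split; nra.
Qed.

Definition mix t f g : classifier X R :=
  Classifier (measurable_mix t f g) (mix_range t f g).

Lemma zero_range (z : X * bool) : 0 <= (cst 0 z : R) <= 1.
Proof. by rewrite lexx ler01. Qed.

Definition zero_classifier : classifier X R :=
  Classifier (measurable_cst (0 : R)) zero_range.

Variable P : probability (X * bool * bool)%type R.

(** The conditional probability of a wrong prediction given (X, A, Y). *)
Definition error f (z : X * bool * bool) : R :=
  if z.2 then 1 - f z.1 else f z.1.

Lemma error_range f z : 0 <= error f z <= 1.
Proof.
by rewrite /error; have := classifier_range f z.1; case: z.2 => /andP[? ?];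
  apply/andP; split; lra.
Qed.

Lemma risk_error f : risk P f = \int[P]_z error f z.
Proof.
congr fine; apply: eq_integral => z _.
(* A Bernoulli law is a weighted sum of Dirac masses at [true] and [false]. For a fixed triple the
   misclassification event contains exactly one of the two labels, the one different from Y, so a
   single weight survives. *)
rewrite bernoulli_probE ?classifier_range// !diracE !mem_xsection /error.
case: z => -[x a] [] /=.
- by rewrite memNset//= mem_set//= mule0 mule1 add0e.
- by rewrite mem_set//= memNset//= mule0 mule1 adde0.
Qed.

Lemma integrable_error f : P.-integrable setT (EFin \o error f).
Proof.
have mf : measurable_fun setT (fun z : X * bool * bool => f z.1).
  by apply: measurableT_comp => //; exact: measurable_classifier.
apply: (@le_integrable _ _ _ P _ measurableT _ (EFin \o cst 1)).
- by apply/measurable_EFinP; apply: measurable_fun_ifT => //;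
    exact: measurable_funB.
- move=> z _ /=; have /andP[e0 e1] := error_range f z.
  by rewrite normr1 lee_fin ger0_norm.
- exact: finite_measure_integrable_cst.
Qed.

Lemma risk_ge0 f : 0 <= risk P f.
Proof.
rewrite risk_error fine_ge0// integral_ge0// => z _.
by rewrite lee_fin; case/andP : (error_range f z).
Qed.

Lemma risk_mix t f g :
  risk P (mix t f g) = t%:num * risk P f + (1 - t%:num) * risk P g.
Proof.
rewrite !risk_error -Rintegral_linear_combination; try exact: integrable_error.
(* Where Y = 1 the error is affine rather than linear in the classifier; its constant 1 splits as t
   + (1 - t). *)
apply: eq_Rintegral => z _; rewrite /error /=; case: z.2 => //; ring.
Qed.

Variables (Dis : classifier X R -> R) (w : X * bool -> R).
Hypothesis hlin : linear_disparity P Dis w.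

Lemma linear_disparity_zero : Dis zero_classifier = 0.
Proof.
by apply: EFin_inj; rewrite hlin.2 integral0_eq// => z _; rewrite mul0r.
Qed.

Lemma linear_disparity_mix t f g :
  Dis (mix t f g) = t%:num * Dis f + (1 - t%:num) * Dis g.
Proof.
(* [law_XA] is a bare set function. Packaging [fst] as a measurable function turns it into the
   measure [mu], to which the integration lemmas apply. *)
pose XA : {mfun (X * bool * bool)%type >-> (X * bool)%type} :=
  HB.pack (@fst (X * bool)%type bool)
    (isMeasurableFun.Build _ _ _ _ _ measurable_fst).
pose mu := distribution P XA.
have DisE (h : classifier X R) : Dis h = \int[mu]_z (h z * w z).
  by rewrite /Rintegral -hlin.2.
(* [Dis h] is a real number, so the integral of [h * w] is finite, which in
   MathComp-Analysis already entails absolute integrability. *)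
have ih (h : classifier X R) :
    mu.-integrable setT (EFin \o (fun z => h z * w z)).
  have mh : measurable_fun setT (fun z => h z * w z).
    apply: measurable_funM; first exact: measurable_classifier.
    by case: hlin.
  apply/integrableP; split; first exact/measurable_EFinP.
  rewrite (@integral_fin_num_abs _ _ _ mu _ _ measurableT mh).
  by have <- := hlin.2 h.
rewrite !DisE -Rintegral_linear_combination//.
by apply: eq_Rintegral => z _ /=; ring.
Qed.

End fair_classification_convexity.

Theorem proposition4p6 (d : measure_display) (X : measurableType d)
    (R : realType) (P : probability (X * bool * bool)%type R)
    (hA : forall a : bool, 0 < prA P a)
    (eta : regression P)
    (Dis : classifier X R -> R) (hDis : disparity_measure Dis)
    (w : X * bool -> R) (hlin : linear_disparity P Dis w)
    (heta : forall a : bool, has_density (pushforward (cond_law_X P a) (eta a)))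
    (hw : forall a : bool,
      has_density (pushforward (cond_law_X P a) (fun x : X => w (x, a)))) :
  convex_function
    (`[0, `|Dis (threshold_classifier eta)|]%classic : set R^o)
    (tradeoff P Dis).
Proof.
apply: (@convex_optimal_value _ _ _ _ (zero_classifier X R)).
- exact: risk_ge0.
- exact: linear_disparity_zero hlin.
- move=> t f g; exists (mix t f g).
  by rewrite risk_mix (linear_disparity_mix hlin).
(* Every level in the interval is nonnegative, which keeps the zero classifier feasible. *)
- by move=> x; rewrite inE /= in_itv /= => /andP[].
Qed.
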